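(* Let $X$ and $Y$ be two finite metric spaces such that $\operatorname{card}(X)=n\le n'=\operatorname{card}(Y)$. Suppose the death times of the finite-length degree-$0$ bars of $X$ and $Y$ are given by the sequences $a_1\ge\dots\ge a_{n-1}$ and $b_1\ge\dots\ge b_{n'-1}$, respectively. Then $$\widehat d_{\mathrm B,0}(X,Y)=\max\left\{\max_{1\le i\le n-1}|a_i-b_i|,\ \max_{n\le i\le n'-1}b_i\right\}$$ (a maximum over an empty index set is taken to be $0$).
   Context: Fix a field $\mathbb{F}$. Finite (pseudo-)metric spaces are nonempty. Vietoris–Rips FCC. For a finite pseudo-metric space $(X,d_X)$, $C_*(\mathrm{VR}(X))$ is the simplicial chain complex over $\mathbb{F}$ of the full simplex on the vertex set $X$ (points at distance $0$ remain distinct vertices), with filtration function $\ell^X(\sum\lambda_i\sigma_i)=\max_{\lambda_i\ne0}\operatorname{diam}(\sigma_i)$ (distinct simplices $\sigma_i$), $\ell^X(0)=-\infty$. Elements $x_1,\dots,x_r$ are orthogonal if $\ell^X(\sum\lambda_ix_i)=\max_{\lambda_i\ne0}\ell^X(x_i)$ for all scalars. Verbose barcode. For $k\ge0$, choose orthogonal ordered bases $(y_1,\dots,y_a)$ of $C_{k+1}$ and $(x_1,\dots,x_m)$ of $\ker\partial_k$ such that, with $r=\operatorname{rank}\partial_{k+1}$, $(y_{r+1},\dots,y_a)$ is a basis of $\ker\partial_{k+1}$, $(x_1,\dots,x_r)$ is a basis of $\operatorname{im}\partial_{k+1}$, and $\partial_{k+1}y_i=x_i$ for $i\le r$. The degree-$k$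 verbose barcode $\mathcal{B}_{\mathrm{Ver},k}(X)$ is the multiset of pairs (bars) $(\ell^X(x_i),\ell^X(y_i))$, $i\le r$, and $(\ell^X(x_i),\infty)$, $r<i\le m$. It does not depend on the choices. The second entry of a bar is its death time; the bar is of finite length if it is finite. (For a metric space with $n$ points the degree-$0$ barcode consists of $n-1$ finite bars $(0,a_i)$ and the bar $(0,\infty)$.) Matching distance. $\|(p,q)-(p',q')\|_\infty=\max\{|p-p'|,|q-q'|\}$ if $q,q'<\infty$, $|p-p'|$ if $q=q'=\infty$, $\infty$ otherwise. $d_{\mathrm M}(A,B)=\inf_\phi\sup_{a\in A}\|a-\phi(a)\|_\infty$ over bijections of multisets $\phi:A\to B$ ($\infty$ if cardinalities differ). Pullback bottleneck distance. A finite tripod between $X$ and $Y$ is a finite set $Z$ with surjections $\phi_X:Z\to X$, $\phi_Y:Z\to Y$. $Z_X$ denotes $Z$ with the pseudo-metric $(z,z')\mapsto d_X(\phi_X(z),\phi_X(z'))$; similarly $Z_Y$. $\widehat d_{\mathrm B,k}(X,Y)=\inf d_{\mathrm M}(\mathcal{B}_{\mathrm{Ver},k}(Z_X),\mathcal{B}_{\mathrm{Ver},k}(Z_Y))$ over finite tripods. *)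

(* Defs.v *)
From HB Require Import structures.
From mathcomp Require Import all_boot all_order all_algebra.
From mathcomp Require Import all_classical all_reals all_analysis.

Set Implicit Arguments.
Unset Strict Implicit.
Unset Printing Implicit Defensive.

Import Order.TTheory GRing.Theory Num.Theory.

Local Open Scope ring_scope.

#[short(type="finMetricType")]
HB.structure Definition FinMetric (R : numDomainType) :=
  { T of Finite T & Metric R T }.

Record pseudoMetricOn (R : realType) (T : Type) := PseudoMetricOn {
  pdist :> T -> T -> R ;
  pdistxx : forall x, pdist x x = 0 ;
  pdist_sym : forall x y, pdist x y = pdist y x ;
  pdist_triangle : forall x y z, pdist x z <= pdist x y + pdist y z }.

Definition metricOn (R : realType) (X : metricType R) : pseudoMetricOn R X :=
  PseudoMetricOn (@mdistxx R X) (@metric_sym R X) (@metric_triangle R X).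

Definition pullbackOn (R : realType) (Z T : Type) (f : Z -> T)
    (d : pseudoMetricOn R T) : pseudoMetricOn R Z :=
  PseudoMetricOn (fun z => pdistxx d (f z))
    (fun z z' => pdist_sym d (f z) (f z'))
    (fun z z' z'' => pdist_triangle d (f z) (f z') (f z'')).

(* Simplices are indexed by their number of vertices, so simplex T k.+1 is the
   set of k-simplices of the full simplex on T, and simplex T 0 is empty. *)
Notation simplex T m := {s : {set T} | (s != finset.set0) && (#|s| == m)}.

(* chain F T k.+1 is C_k; in particular chain F T 0, which is C_(-1), is 0. *)
Notation chain F T m := {ffun simplex T m -> F^o}.

(* Simplices are oriented by the enumeration order of T. If the vertices of s
   are v_0 < v_1 < ..., then removing v_i contributes the sign (-1)^i, where i
   is the number of vertices of s that precede v_i. *)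
Definition incidence (F : fieldType) (T : finType) (s t : {set T}) : F :=
  \sum_(v in s | s :\ v == t)
    (-1) ^+ #|[set u in s | (enum_rank u < enum_rank v)%N]|.

Definition bdry_fun (F : fieldType) (T : finType) (m : nat)
    (c : chain F T m.+1) : chain F T m :=
  [ffun t => \sum_s c s * incidence F (val s) (val t)].

Lemma bdry_fun_is_linear (F : fieldType) (T : finType) (m : nat) :
  linear (@bdry_fun F T m).
Proof.
move=> a u v; apply/ffunP => t; rewrite !ffunE scaler_sumr -big_split /=.
by apply: eq_bigr => s _; rewrite !ffunE mulrDl scalerAl.
Qed.

HB.instance Definition _ (F : fieldType) (T : finType) (m : nat) :=
  GRing.isLinear.Build F (chain F T m.+1) (chain F T m) _
    (@bdry_fun F T m) (@bdry_fun_is_linear F T m).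

(* bdry F T k : C_k -> C_(k-1) *)
Definition bdry (F : fieldType) (T : finType) (k : nat) :
    'Hom(chain F T k.+1, chain F T k) :=
  linfun (@bdry_fun F T k).

(* Distances are nonnegative, so 0 is a neutral starting value. *)
Definition diam (R : realType) (T : finType) (d : pseudoMetricOn R T)
    (s : {set T}) : R :=
  \big[Num.max/0]_(x in s) \big[Num.max/0]_(y in s) d x y.

Definition level (R : realType) (F : fieldType) (T : finType)
    (d : pseudoMetricOn R T) (m : nat) (c : chain F T m) : \bar R :=
  \big[maxe/-oo%E]_(s | c s != 0) (diam d (val s))%:E.

Definition level_orthogonal (R : realType) (F : fieldType) (T : finType)
    (d : pseudoMetricOn R T) (m : nat) (xs : seq (chain F T m)) : Prop :=
  forall lam : 'I_(size xs) -> F,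
    level d (\sum_i lam i *: xs`_i) =
    \big[maxe/-oo%E]_(i | lam i != 0) level d xs`_i.

Definition bar (R : realType) : Type := (\bar R * \bar R)%type.

(* Multisets of bars are lists up to permutation; B is any list presenting the
   degree-k verbose barcode. *)
Definition is_verbose_barcode (R : realType) (F : fieldType) (T : finType)
    (d : pseudoMetricOn R T) (k : nat) (B : seq (bar R)) : Prop :=
  exists (ys : seq (chain F T k.+2)) (xs : seq (chain F T k.+1)),
    let r := \dim (limg (bdry F T k.+1)) in
    [/\ level_orthogonal d ys /\ basis_of fullv ys,
        level_orthogonal d xs /\ basis_of (lker (bdry F T k)) xs,
        basis_of (lker (bdry F T k.+1)) (drop r ys) /\
        basis_of (limg (bdry F T k.+1)) (take r xs),
        forall i, (i < r)%N -> bdry F T k.+1 ys`_i = xs`_i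
      & perm_eq B
          [seq (level d xs`_i, if (i < r)%N then level d ys`_i else +oo%E)
          | i <- iota 0 (size xs)]].

Definition bar_dist (R : realType) (a b : bar R) : \bar R :=
  match a.2, b.2 with
  | q%:E, q'%:E => maxe `|a.1 - b.1| `|q%:E - q'%:E|
  | +oo, +oo => `|a.1 - b.1|
  | _, _ => +oo
  end%E.

(* There is no bijection, and the infimum is +oo, if the cardinalities differ;
   the costs are nonnegative, so the supremum over the empty set is 0. *)
Definition matching_dist (R : realType) (A B : seq (bar R)) : \bar R :=
  ereal_inf [set c | exists2 phi : 'I_(size A) -> 'I_(size B), bijective phi &
    c = \big[maxe/0%E]_i
          bar_dist (tnth (in_tuple A) i) (tnth (in_tuple B) (phi i))]%classic.

Definition pullback_bottleneck (R : realType) (F : fieldType) (k : nat)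
    (X Y : finMetricType R) : \bar R :=
  ereal_inf [set c | exists (Z : finType) (phiX : Z -> X) (phiY : Z -> Y)
      (A B : seq (bar R)),
    [/\ set_surj setT setT phiX, set_surj setT setT phiY,
        is_verbose_barcode F (pullbackOn phiX (metricOn X)) k A,
        is_verbose_barcode F (pullbackOn phiY (metricOn Y)) k B
      & c = matching_dist A B]]%classic.

Definition finite_death_times (R : realType) (B : seq (bar R)) : seq (\bar R) :=
  [seq b.2 | b <- B & (b.2 < +oo)%E].

(* Main.v *)
(* For t >= 0 let E_t be the span in C_0 of the differences u - v with
   d(u, v) <= t. By orthogonality, the number of finite degree-0 bars with
   death at most t is dim E_t. For a surjection f : Z -> X, the map induced by
   f on C_0 sends E_t(Z_X) onto E_t(X), and its kernel lies in E_t(Z_X), since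
   points of a fibre of f are at distance 0. Hence dim E_t(Z_X) is
   dim E_t(X) + |Z| - |X|, that is, the barcode of Z_X is that of X with
   |Z| - |X| extra bars (0, 0). For every tripod the best matching is the
   sorted one, whose cost is the right-hand side, so any tripod attains the
   infimum. *)
Require Import Defs.
From HB Require Import structures.
From mathcomp Require Import all_boot all_order all_algebra.
From mathcomp Require Import all_classical all_reals all_analysis.
From mathcomp Require Import zify lra.

Set Implicit Arguments.
Unset Strict Implicit.
Unset Printing Implicit Defensive.

Import Order.TTheory GRing.Theory Num.Theory.
Local Open Scope ring_scope.

(** * Levels of chains and sublevel spaces *)

Lemma diam_ge0 (R : realType) (T : finType) (d : pseudoMetricOn R T)
  (s : {set T}) : 0 <= diam d s.
Proof. exact: bigmax_ge_id. Qed.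

Lemma level_leP (R : realType) (F : fieldType) (T : finType)
    (d : pseudoMetricOn R T) (m : nat) (c : chain F T m) (t : R) :
  reflect (forall s, c s != 0 -> diam d (val s) <= t) (level d c <= t%:E)%E.
Proof.
apply: (iffP (bigmax_leP _ _ _ _)) => [[_ h] s /h|h]; first by rewrite lee_fin.
by split=> [|s /h]; rewrite ?leNye ?lee_fin.
Qed.

Lemma level0 (R : realType) (F : fieldType) (T : finType)
    (d : pseudoMetricOn R T) (m : nat) : level d (0 : chain F T m) = -oo%E.
Proof. by rewrite /level big_pred0 // => s; rewrite ffunE eqxx. Qed.

Lemma chain_neq0P (F : fieldType) (T : finType) (m : nat) (c : chain F T m) :
  reflect (exists s, c s != 0) (c != 0).
Proof.
apply: (iffP idP) => [c0|[s]]; last by apply: contraNneq => ->; rewrite ffunE.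
apply/existsP; apply: contraNT c0 => /existsPn h; apply/eqP/ffunP => s.
by rewrite ffunE; apply/eqP; rewrite -[_ == _]negbK.
Qed.

Lemma level_fin (R : realType) (F : fieldType) (T : finType)
    (d : pseudoMetricOn R T) (m : nat) (c : chain F T m) :
  c != 0 -> exists2 s, c s != 0 & level d c = (diam d (val s))%:E.
Proof.
move=> /chain_neq0P[s cs].
(* The starting value 0 is harmless because diameters are nonnegative. *)
have [|u cu eqM] := @eq_bigmax _ _ _ 0 s (fun s => c s != 0)
  (fun s => diam d (val s)) cs; first by move=> *; exact: diam_ge0.
exists u => //; apply/eqP; rewrite eq_le; apply/andP; split.
  by apply/level_leP => v cv; rewrite -eqM; apply: (bigmax_sup v).
by apply: (bigmax_sup u).
Qed.

Lemma level_eqNy (R : realType) (F : fieldType) (T : finType)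
    (d : pseudoMetricOn R T) (m : nat) (c : chain F T m) :
  (level d c == -oo%E) = (c == 0).
Proof.
have [->|/(level_fin d)[s _ ->//]] := eqVneq c 0; first by rewrite level0.
Qed.

Lemma orthogonal_le (R : realType) (F : fieldType) (T : finType)
    (d : pseudoMetricOn R T) (m : nat) (xs : seq (chain F T m))
    (lam : 'I_(size xs) -> F) (t : R) (i : 'I_(size xs)) :
  level_orthogonal d xs -> (level d (\sum_i lam i *: xs`_i)%R <= t%:E)%E ->
  lam i != 0 -> (level d xs`_i <= t%:E)%E.
Proof.
by move=> /(_ lam) -> le_t lami; apply: le_trans le_t; apply: (bigmax_sup i).
Qed.

(* The chains of level at most [t] are the kernel of this linear map, which
   makes them a {vspace _}. *)
Definition truncate (R : realType) (F : fieldType) (T : finType)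
    (d : pseudoMetricOn R T) (t : R) (m : nat) (c : chain F T m) : chain F T m :=
  [ffun s => if diam d (val s) <= t then 0 else c s].

Lemma truncate_is_linear (R : realType) (F : fieldType) (T : finType)
  (d : pseudoMetricOn R T) (t : R) (m : nat) : linear (@truncate R F T d t m).
Proof.
move=> a u v; apply/ffunP => s; rewrite !ffunE.
by case: ifP => // _; rewrite scaler0 addr0.
Qed.

HB.instance Definition _ (R : realType) (F : fieldType) (T : finType)
    (d : pseudoMetricOn R T) (t : R) (m : nat) :=
  GRing.isLinear.Build F (chain F T m) (chain F T m) _
    (@truncate R F T d t m) (@truncate_is_linear R F T d t m).

Definition sublevel (R : realType) (F : fieldType) (T : finType)
    (d : pseudoMetricOn R T) (t : R) (m : nat) : {vspace (chain F T m)} :=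
  lker (linfun (@truncate R F T d t m)).

Lemma mem_sublevel (R : realType) (F : fieldType) (T : finType)
    (d : pseudoMetricOn R T) (t : R) (m : nat) (c : chain F T m) :
  (c \in sublevel F d t m) = (level d c <= t%:E)%E.
Proof.
rewrite memv_ker lfunE /=; apply/eqP/level_leP => [/ffunP c0 s cs|h].
  by move: (c0 s); rewrite !ffunE; case: ifP => // _ /eqP; rewrite (negPf cs).
apply/ffunP => s; rewrite !ffunE; case: ifPn => // le_t.
by apply/eqP; apply: contraNT le_t; apply: h.
Qed.

(** * Counting deaths by dimensions of boundary spaces *)

Lemma bdryE (F : fieldType) (T : finType) (k : nat) (c : chain F T k.+1) :
  bdry F T k c = bdry_fun c.
Proof. by rewrite lfunE. Qed.

(** By orthogonality, a chain of level at most [t] only involves elements of [ys] of level at most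
    [t]. The boundary kills those from index [r] on and sends the others to independent elements of
    [xs], which form a basis of the image. *)
Lemma dim_bdry_sublevel (R : realType) (F : fieldType) (T : finType)
    (d : pseudoMetricOn R T) (k : nat) (t : R) (r : nat)
    (ys : seq (chain F T k.+1)) (xs : seq (chain F T k)) :
  level_orthogonal d ys -> <<ys>>%VS = fullv -> free xs -> (r <= size xs)%N ->
  {subset drop r ys <= lker (bdry F T k)} ->
  (forall i, (i < r)%N -> bdry F T k ys`_i = xs`_i) ->
  \dim (bdry F T k @: sublevel F d t k.+1)%VS =
  count (fun y => level d y <= t%:E)%E [seq ys`_i | i <- iota 0 r].
Proof.
move=> oys ys_full xs_free le_r ker_ys bd_ys.
pose L := [seq xs`_i | i <- iota 0 r & (level d ys`_i <= t%:E)%E].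
(* Appending the remaining indices turns [L] into a permutation of the free family [xs]. *)
have L_free : free L.
  have : perm_eq xs (L ++ [seq xs`_i | i <- iota 0 (size xs) &
                                ~~ ((i < r)%N && (level d ys`_i <= t%:E)%E)]).
    rewrite -{1}[xs](mkseq_nth 0) /mkseq /L.
    have -> : [seq i <- iota 0 r | (level d ys`_i <= t%:E)%E] =
        [seq i <- iota 0 (size xs) | (i < r)%N && (level d ys`_i <= t%:E)%E].
      rewrite -[in RHS](subnKC le_r) iotaD filter_cat add0n.
      rewrite [X in _ ++ X](_ : _ = [::]) ?cats0.
        by apply: eq_in_filter => i; rewrite mem_iota add0n => /andP[_ ->].
      rewrite -(filter_pred0 (iota r (size xs - r))); apply: eq_in_filter => i.
      by rewrite mem_iota => /andP[ri _]; rewrite ltnNge ri.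
    by rewrite -map_cat perm_map // perm_sym perm_filterC.
  by move/perm_free; rewrite xs_free => /esym/catl_free.
rewrite count_map -size_filter -(size_map (fun i => xs`_i)) -/L -(eqnP L_free).
congr (\dim _); apply/eqP; rewrite eqEsubv; apply/andP; split; last first.
  apply/span_subvP => x /mapP[i]; rewrite mem_filter mem_iota add0n.
  case/andP=> le_t /= ir ->; rewrite -bd_ys //.
  by apply: memv_img; rewrite mem_sublevel.
apply/subvP => _ /memv_imgP[c + ->]; rewrite mem_sublevel.
have /(@coord_span _ _ _ (in_tuple ys)) -> : c \in <<ys>>%VS.
  by rewrite ys_full memvf.
move=> le_t; rewrite linear_sum; apply: memv_suml => i _; rewrite linearZ /=.
(* A zero coordinate says nothing about the level of its basis element, so it is set aside before
   orthogonality is used. *)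
have [->|lam0] := eqVneq (coord (in_tuple ys) i c) 0.
  by rewrite scale0r mem0v.
have lei := orthogonal_le oys le_t lam0; apply: memvZ.
have [ir|ri] := ltnP i r.
  rewrite bd_ys //; apply/memv_span/mapP; exists (i : nat) => //.
  by rewrite mem_filter lei mem_iota.
have /ker_ys : ys`_i \in drop r ys.
  by rewrite -[X in _`_X](subnKC ri) -nth_drop mem_nth // size_drop ltn_sub2r //
     (leq_ltn_trans ri).
by rewrite memv_ker => /eqP ->; rewrite mem0v.
Qed.

(** * Vertices, edges and the spans of short differences *)

Definition delta_chain (F : fieldType) (T : finType) (m : nat)
  (s : simplex T m) : chain F T m := [ffun s' => (s' == s)%:R].

Lemma chain_sum_delta (F : fieldType) (T : finType) (m : nat)
  (c : chain F T m) : c = \sum_s c s *: delta_chain F s.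
Proof.
apply/ffunP => s; rewrite sum_ffunE (bigD1 s) //= big1 => [|s' ss'].
  by rewrite !ffunE eqxx addr0 /GRing.scale /= mulr1.
by rewrite !ffunE eq_sym (negPf ss') scaler0.
Qed.

Lemma level_delta (R : realType) (F : fieldType) (T : finType)
    (d : pseudoMetricOn R T) (m : nat) (s : simplex T m) :
  level d (delta_chain F s) = (diam d (val s))%:E.
Proof.
rewrite /level (big_pred1 s) // => s'; rewrite ffunE.
rewrite -[RHS]/(s' == s); case: (s' == s); first by rewrite oner_neq0.
by rewrite eqxx.
Qed.

Lemma vertex_subproof (T : finType) (v : T) :
  ([set v] != finset.set0) && (#|[set v]| == 1%N).
Proof. by rewrite cards1 eqxx andbT -card_gt0 cards1. Qed.

Definition vertex (T : finType) (v : T) : simplex T 1 :=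
  exist _ [set v] (vertex_subproof v).

Lemma vertex_bij (T : finType) : bijective (@vertex T).
Proof.
apply: inj_card_bij => [u v /(congr1 val)|]; first exact: set1_inj.
rewrite card_sig -(card_imset predT set1_inj); apply: subset_leq_card.
apply/fintype.subsetP => s /andP[_ /cards1P[v ->]]; exact: imset_f.
Qed.

Lemma edge_subproof (T : finType) (u v : T) : u != v ->
  ([set u; v] != finset.set0) && (#|[set u; v]| == 2%N).
Proof. by move=> uv; rewrite -card_gt0 !cards2 uv. Qed.

Definition pt (F : fieldType) (T : finType) (v : T) : chain F T 1 :=
  delta_chain F (vertex v).

Lemma chain1_sum_pt (F : fieldType) (T : finType) (c : chain F T 1) :
  c = \sum_v c (vertex v) *: pt F v.
Proof.
rewrite [LHS]chain_sum_delta (reindex (@vertex T)) //.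
exact/onW_bij/vertex_bij.
Qed.

(** No vertex precedes [u], so removing it leaves [v] with sign +1; only [u] precedes [v], so
    removing [v] leaves [u] with sign -1. *)
Lemma bdry_edge (F : fieldType) (T : finType) (s : simplex T 2) (u v : T) :
  val s = [set u; v] -> (enum_rank u < enum_rank v)%N ->
  bdry F T 1 (delta_chain F s) = pt F v - pt F u.
Proof.
move=> sE uv; have neq_uv : u != v by apply: contraTneq uv => ->; rewrite ltnn.
apply/ffunP => t; have [w ->] : exists w, t = vertex w.
  by have [g _ gK] := vertex_bij T; exists (g t).
rewrite bdryE !ffunE (bigD1 s) //= big1 ?addr0 => [|s' ss']; last first.
  by rewrite ffunE (negPf ss') mul0r.
rewrite ffunE eqxx mul1r sE !(inj_eq (bij_inj (vertex_bij T))).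
rewrite /incidence /= big_mkcondr /= big_setU1 ?inE //= big_set1.
rewrite setU1K ?inE // (finset.setUC [set u]) setU1K ?inE 1?eq_sym // !(inj_eq set1_inj).
rewrite (_ : [set _ in _ | _] = finset.set0); last first.
  apply/setP => x; rewrite !inE; apply/negbTE.
  by apply/negP => /andP[/orP[]/eqP->]; rewrite ?ltnn // ltnNge ltnW.
rewrite (_ : [set _ in _ | _] = [set u]); last first.
  apply/setP => x; rewrite !inE.
  have [->|] := eqVneq x v; first by rewrite ltnn andbF eq_sym (negPf neq_uv).
  by have [->|] := eqVneq x u; rewrite ?uv.
rewrite cards0 cards1 expr0 expr1 !(eq_sym w).
by case: (v == w); case: (u == w);
  rewrite !(mulr0n, mulr1n, oppr0, addr0, add0r, subrr).
Qed.

(** The dimension of this space is [#|T|] minus the number of connected components of the graph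
    joining points with [d u v <= t]. *)
Definition edge_span (R : realType) (F : fieldType) (T : finType)
    (d : T -> T -> R) (t : R) : {vspace (chain F T 1)} :=
  span [seq pt F p.1 - pt F p.2 | p <- enum {: T * T} & d p.1 p.2 <= t].

Lemma mem_edge_span (R : realType) (F : fieldType) (T : finType)
    (d : T -> T -> R) (t : R) (u v : T) :
  d u v <= t -> pt F u - pt F v \in edge_span F d t.
Proof.
move=> uv; apply/memv_span/mapP; exists (u, v) => //.
by rewrite mem_filter /= uv mem_enum.
Qed.

Lemma edge_span_subvP (R : realType) (F : fieldType) (T : finType)
    (d : T -> T -> R) (t : R) (U : {vspace (chain F T 1)}) :
  reflect (forall u v, d u v <= t -> pt F u - pt F v \in U)
          (edge_span F d t <= U)%VS.
Proof.
apply: (iffP idP) => [/subvP sU u v uv|h]; first exact/sU/mem_edge_span.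
apply/span_subvP => _ /mapP[p + ->]; rewrite mem_filter => /andP[le_t _].
exact: h.
Qed.

Lemma pdist_ge0 (R : realType) (T : Type) (d : pseudoMetricOn R T) (x y : T) :
  0 <= d x y.
Proof.
by move: (pdist_triangle d x y x); rewrite pdistxx (pdist_sym d y) -mulr2n pmulrn_lge0.
Qed.

Lemma diam_edge (R : realType) (T : finType) (d : pseudoMetricOn R T)
  (u v : T) : diam d [set u; v] = d u v.
Proof.
apply/eqP; rewrite eq_le; apply/andP; split.
  apply: bigmax_le => [|x xs]; first exact: pdist_ge0.
  apply: bigmax_le => [|y ys]; first exact: pdist_ge0.
  move: xs ys; rewrite !inE => /orP[]/eqP-> /orP[]/eqP->;
    by rewrite ?pdistxx ?pdist_ge0 ?lexx // pdist_sym lexx.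
by apply: (bigmax_sup u); rewrite ?inE ?eqxx //;
  apply: (bigmax_sup v); rewrite ?inE ?eqxx ?orbT.
Qed.

Lemma bdry_edge_pm (F : fieldType) (T : finType) (s : simplex T 2) (u v : T) :
  val s = [set u; v] -> u != v ->
  exists e : bool, bdry F T 1 (delta_chain F s) = (-1) ^+ e *: (pt F u - pt F v).
Proof.
move=> sE uv; have := uv; rewrite -(inj_eq enum_rank_inj) -val_eqE neq_ltn.
case/orP => rk_lt; last first.
  by exists false; rewrite scale1r (@bdry_edge F T s v u) // finset.setUC.
by exists true; rewrite scaleN1r opprB (@bdry_edge F T s u v).
Qed.

(** The edges of length at most [t] span the sublevel space, and each has a difference of endpoints
    as boundary, up to a sign that spans ignore. Pairs with [u = v] contribute 0. *)
Lemma bdry_sublevel_edges (R : realType) (F : fieldType) (T : finType)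
    (d : pseudoMetricOn R T) (t : R) :
  (bdry F T 1 @: sublevel F d t 2)%VS = edge_span F d t.
Proof.
apply/eqP; rewrite eqEsubv; apply/andP; split.
  apply/subvP => _ /memv_imgP[c + ->]; rewrite mem_sublevel => /level_leP le_t.
  rewrite (chain_sum_delta c) linear_sum; apply: memv_suml => s _.
  rewrite linearZ /=; have [->|/le_t] := eqVneq (c s) 0.
    by rewrite scale0r mem0v.
  case/andP: (valP s) => _ /cards2P[u [v [uv sE]]]; rewrite sE diam_edge => duv.
  have [e ->] := @bdry_edge_pm F T s u v sE uv.
  by do 2!apply: memvZ; exact: mem_edge_span.
apply/edge_span_subvP => u v duv.
have [->|uv] := eqVneq u v; first by rewrite subrr mem0v.
pose s : simplex T 2 := exist _ [set u; v] (edge_subproof uv).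
have [e eE] := @bdry_edge_pm F T s u v erefl uv.
rewrite -[X in X \in _]scale1r -(signrMK e 1) mulr1 -scalerA -eE -linearZ.
apply/memv_img/memvZ; rewrite mem_sublevel level_delta lee_fin /=.
by rewrite diam_edge.
Qed.

(** * Pushforward of 0-chains and edge spans of pullbacks *)

Definition pushforward (F : fieldType) (Z T : finType) (f : Z -> T)
  (c : chain F Z 1) : chain F T 1 := \sum_v c (vertex v) *: pt F (f v).

Lemma pushforward_is_linear (F : fieldType) (Z T : finType) (f : Z -> T) :
  linear (@pushforward F Z T f).
Proof.
move=> a u v; rewrite /pushforward scaler_sumr -big_split /=.
by apply: eq_bigr => x _; rewrite !ffunE scalerDl scalerA.
Qed.

HB.instance Definition _ (F : fieldType) (Z T : finType) (f : Z -> T) :=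
  GRing.isLinear.Build F (chain F Z 1) (chain F T 1) _
    (@pushforward F Z T f) (@pushforward_is_linear F Z T f).

Lemma pushforward_pt (F : fieldType) (Z T : finType) (f : Z -> T) (v : Z) :
  pushforward f (pt F v) = pt F (f v).
Proof.
rewrite /pushforward (bigD1 v) //= big1 => [|u uv].
  by rewrite !ffunE eqxx scale1r addr0.
by rewrite !ffunE (inj_eq (bij_inj (vertex_bij Z))) (negPf uv) scale0r.
Qed.

Lemma dim_chain0 (F : fieldType) (T : finType) : \dim {:chain F T 0} = 0%N.
Proof.
apply/eqP; rewrite dimv_eq0 -subv0; apply/subvP => c _; rewrite memv0.
apply/eqP/ffunP => s; case/andP: (valP s) => s0 /eqP/eqP.
by rewrite cards_eq0 (negPf s0).
Qed.

Lemma dim_chain1 (F : fieldType) (T : finType) : \dim {:chain F T 1} = #|T|.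
Proof.
rewrite dimvf /dim /= /dim /= muln1; symmetry.
exact: bij_eq_card (vertex_bij T).
Qed.

(* The kernel of the pushforward along [f] is spanned by the [pt z - pt z']
   with [f z = f z'], which are edges of length 0 in the pullback. *)
Lemma dim_edge_span_pullback (R : realType) (F : fieldType) (Z T : finType)
    (d : pseudoMetricOn R T) (f : Z -> T) (g : T -> Z) (t : R) :
  cancel g f -> 0 <= t ->
  \dim (edge_span F (pullbackOn f d) t) =
  (\dim (edge_span F d t) + (#|Z| - #|T|))%N.
Proof.
move=> gK t0; pose p := linfun (@pushforward F Z T f).
have p_pt v : p (pt F v) = pt F (f v) by rewrite lfunE /= pushforward_pt.
have ker_sub : (lker p <= edge_span F (pullbackOn f d) t)%VS.
  apply/subvP => c; rewrite memv_ker => /eqP pc0.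
  (* Subtracting the pushforward of [p c = 0] along the section [g] replaces each vertex by a
     difference within a fibre of [f]. *)
  have -> : c = \sum_z c (vertex z) *: (pt F z - pt F (g (f z))).
    have : pushforward g (p c) = 0 by rewrite pc0 linear0.
    rewrite [in p c](chain1_sum_pt c) !linear_sum => pgc0.
    apply/eqP; rewrite -subr_eq0 [X in X - _](chain1_sum_pt c) -sumrB.
    rewrite -[X in _ == X]pgc0; apply/eqP/eq_bigr => z _.
    by rewrite scalerBr opprB addrC subrK !linearZ /= p_pt pushforward_pt.
  apply: memv_suml => z _; apply/memvZ/mem_edge_span.
  by rewrite /= gK pdistxx.
(* Rank-nullity on the edge span: its image is the edge span of [d], and the kernel has dimension
   [#|Z| - #|T|] because [p] is onto. *)
rewrite -(limg_ker_dim p) (capv_idPr ker_sub) addnC; congr addn.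
  congr (\dim _); apply/eqP; rewrite eqEsubv; apply/andP; split; last first.
    apply/edge_span_subvP => u v uv; rewrite -(gK u) -(gK v) -!p_pt -linearB.
    by apply/memv_img/mem_edge_span; rewrite /= !gK.
  rewrite limg_span; apply/span_subvP => _ /mapP[_ /mapP[[u v] + ->] ->].
  rewrite mem_filter linearB /= !p_pt => /andP[uv _]; exact: mem_edge_span.
have <- : \dim (limg p) = #|T|.
  rewrite -(dim_chain1 F T); congr (\dim _); apply/eqP; rewrite eqEsubv subvf.
  apply/subvP => c _; rewrite (chain1_sum_pt c); apply: memv_suml => v _.
  by rewrite -(gK v) -p_pt -linearZ memv_img ?memvf.
by rewrite -(dim_chain1 F Z) -(limg_ker_dim p fullv) capfv addnK.
Qed.

(** * The degree-0 barcode and its death counts *)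

Lemma edge_span_neg (R : realType) (F : fieldType) (T : finType)
    (d : pseudoMetricOn R T) (t : R) : t < 0 -> edge_span F d t = 0%VS.
Proof.
move=> t0; apply/eqP; rewrite -subv0; apply/edge_span_subvP => u v.
by move=> /(le_trans (pdist_ge0 d u v)); rewrite leNgt t0.
Qed.

Lemma level_chain1 (R : realType) (F : fieldType) (T : finType)
    (d : pseudoMetricOn R T) (c : chain F T 1) :
  c != 0 -> level d c = 0%:E.
Proof.
move=> /(level_fin d)[s _ ->]; congr EFin.
have [g _ gK] := vertex_bij T; rewrite -(gK s) /=.
(* A singleton is a degenerate edge, of length the distance of a point to itself. *)
by rewrite -[[set _]]finset.setUid diam_edge pdistxx.
Qed.

Lemma lker_bdry0 (F : fieldType) (T : finType) : lker (bdry F T 0) = fullv.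
Proof.
apply/eqP; rewrite eqEdim subvf -(limg_ker_dim (bdry F T 0) fullv) capfv.
rewrite -[leqRHS]addn0 leq_add2l.
by apply: leq_trans (dimvS (subvf _)) _; rewrite dim_chain0.
Qed.

Lemma eq_in_map_const (S : eqType) (T : Type) (f : S -> T) (c : T) (s : seq S) :
  {in s, forall x, f x = c} -> map f s = nseq (size s) c.
Proof.
elim: s => //= x s IH fc; rewrite fc ?mem_head ?IH // => y ys.
by rewrite fc // inE ys orbT.
Qed.

(** Births are 0 since nonzero 0-chains have level 0. The deaths are the levels of the first [r]
    elements of [ys], which [dim_bdry_sublevel] counts. The count depends on [d] alone, so the
    barcode is independent of the bases. *)
Lemma verbose_barcode0P (R : realType) (F : fieldType) (T : finType)
    (d : pseudoMetricOn R T) (B : seq (bar R)) :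
  is_verbose_barcode F d 0 B ->
  exists D : seq R,
    [/\ perm_eq B ([seq (0%:E, x%:E) | x <- D] ++
                   nseq (#|T| - size D) (0%:E, +oo%E)),
        (size D <= #|T|)%N &
        forall t, count (<= t) D = \dim (edge_span F d t)].
Proof.
move=> [ys [xs []]]; set r := \dim _ => -[oys bys] [_ bxs] [bker bim] bd permB.
have sxs : size xs = #|T|.
  rewrite -(dim_chain1 F T) -(lker_bdry0 F T).
  by rewrite -(@size_basis _ _ _ _ (in_tuple xs) bxs).
have r_xs : (r <= size xs)%N.
  by rewrite {1}/r (@size_basis _ _ _ _ (in_tuple (take r xs)) bim) size_take geq_minr.
have r_ys : (r <= size ys)%N.
  rewrite -(@size_basis _ _ _ _ (in_tuple ys) bys) /r.
  by rewrite -(limg_ker_dim (bdry F T 1) fullv) leq_addl.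
(* Basis elements are nonzero, so [fine] never meets an infinite level here. *)
have level_ys i : (i < r)%N -> level d ys`_i = (fine (level d ys`_i))%:E.
  move=> ir; have /(level_fin d)[s _ ->//] : ys`_i != 0.
  by apply: basis_not0 bys _; rewrite mem_nth // (leq_trans ir).
exists [seq fine (level d ys`_i) | i <- iota 0 r]; split.
- apply: (perm_trans permB); rewrite size_map size_iota -sxs.
  rewrite -[X in iota 0 X](subnKC r_xs) iotaD map_cat -map_comp.
  have xs_level i : (i < size xs)%N -> level d xs`_i = 0%:E.
    by move=> ir; apply/level_chain1/(basis_not0 bxs)/mem_nth.
  rewrite (_ : map _ (iota 0 r) =
    [seq (0%:E, (fine (level d ys`_i))%:E) | i <- iota 0 r]); last first.
    apply/eq_in_map => i; rewrite mem_iota add0n => /andP[_ ir].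
    by rewrite ir -level_ys // xs_level // (leq_trans ir).
  rewrite [map _ (iota (0 + r) _)](@eq_in_map_const _ _ _ (0%:E, +oo%E)).
    by rewrite size_iota.
  move=> i; rewrite mem_iota add0n subnKC // => /andP[ri ir] /=.
  by rewrite ltnNge ri xs_level.
- by rewrite size_map size_iota -sxs.
- move=> t; rewrite -bdry_sublevel_edges.
  rewrite (@dim_bdry_sublevel _ _ _ d 1 t r ys xs oys) //.
  + rewrite !count_map; apply: eq_in_count => i; rewrite mem_iota => /andP[_ ir].
    by rewrite /= [in RHS]level_ys.
  + by case/andP: bys => /eqP.
  + exact: basis_free bxs.
  + by move=> y /(basis_mem bker).
Qed.

(** The multiplicity of [x] is the jump of the counting function at [x]. *)
Lemma perm_eq_count_le (R : realType) (s1 s2 : seq R) :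
  (forall t, count (<= t) s1 = count (<= t) s2) -> perm_eq s1 s2.
Proof.
move=> eq12; suff count1 x : count_mem x s1 = count_mem x s2.
  by apply/allP => x _ /=; rewrite count1.
(* The witness is the maximum of [x - 1] and all entries below [x]; taking it over both lists makes
   one [t] serve for both. *)
have [t tx allt] : exists2 t, t < x & all (fun y => (y < x) ==> (y <= t)) (s1 ++ s2).
  elim: (s1 ++ s2) => [|y s [t tx IH]]; first by exists (x - 1); rewrite ?ltrBlDr ?ltrDl.
  exists (if y < x then Num.max t y else t); first by case: ifP => // yx; rewrite gt_max tx.
  apply/andP; split; first by apply/implyP => ->; rewrite le_max lexx orbT.
  apply: sub_all IH => z /implyP zt; apply/implyP => /zt; case: ifP => // _ le_zt.
  by rewrite le_max le_zt.
have countE s : all (fun y => (y < x) ==> (y <= t)) s ->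
    count (<= x) s = (count (<= t) s + count_mem x s)%N.
  elim: s => //= y s IH /andP[/implyP yt /IH ->]; rewrite addnACA; congr addn.
  case: (ltgtP y x) => [/yt->|xy|->] //; last by rewrite leNgt tx.
  by rewrite leNgt (lt_trans tx xy).
move: allt; rewrite all_cat => /andP[/countE + /countE].
by rewrite !eq12 => -> /addnI.
Qed.

Lemma surj_section (Z T : finType) (f : Z -> T) :
  set_surj setT setT f -> exists g, cancel g f.
Proof.
move=> f_surj; have /choice[g gK] : forall x, exists z, f z = x.
  by move=> x; have [z _ fz] := f_surj x I; exists z.
by exists g.
Qed.

(** * Death times and barcodes of pullbacks *)

Lemma perm_finite_death_times (R : realType) (B : seq (bar R)) (D : seq R)
    (k : nat) :
  perm_eq B ([seq (0%:E, x%:E) | x <- D] ++ nseq k (0%:E, +oo%E)) ->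
  perm_eq (finite_death_times B) (map EFin D).
Proof.
move=> permB; rewrite /finite_death_times.
rewrite (perm_trans (perm_map _ (perm_filter _ permB))) //.
rewrite filter_cat map_cat filter_map -map_comp.
rewrite (eq_filter (a2 := predT)) => [|x /=]; last by rewrite ltry.
by rewrite filter_predT filter_nseq cats0; exact: perm_refl.
Qed.

Lemma death_times_ge0 (R : realType) (F : fieldType) (T : finType)
    (d : pseudoMetricOn R T) (B : seq (bar R)) (x : R) :
  is_verbose_barcode F d 0 B -> x%:E \in finite_death_times B -> 0 <= x.
Proof.
move=> /verbose_barcode0P[D [permB _ cntB]].
rewrite (perm_mem (perm_finite_death_times permB)) (mem_map (@EFin_inj R)) => Dx.
rewrite leNgt; apply/negP => x0.
have : has (<= x) D by apply/hasP; exists x => //=; rewrite inE.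
by rewrite has_count cntB edge_span_neg // dimv0.
Qed.

(* Death times of a pullback in decreasing order. The infinite bar has index 0,
   so that the indexing of [a] from 1 is kept. *)
Definition padded_death (R : realType) (n : nat) (a : nat -> R) (i : nat) :
    \bar R :=
  if i == 0%N then +oo%E else if (i < n)%N then (a i)%:E else 0%:E.

Definition barcode_of_deaths (R : realType) (del : nat -> \bar R) (N : nat) :
  seq (bar R) := [seq (0%:E, del i) | i <- iota 0 N].

(** The numbers of deaths at most [t] in the pullback and in [T] differ by [#|Z| - #|T|] for
    [t >= 0] and both vanish for [t < 0], so the pullback only gains zero deaths. *)
Lemma barcode_pullback (R : realType) (F : fieldType) (Z T : finType)
    (d : pseudoMetricOn R T) (f : Z -> T) (a : nat -> R) (A B : seq (bar R)) :
  (0 < #|T|)%N -> set_surj setT setT f -> is_verbose_barcode F d 0 B ->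
  perm_eq (finite_death_times B) [seq (a i)%:E | i <- index_iota 1 #|T|] ->
  is_verbose_barcode F (pullbackOn f d) 0 A ->
  perm_eq A (barcode_of_deaths (padded_death #|T| a) #|Z|).
Proof.
move=> T0 f_surj /verbose_barcode0P[D [permB _ cntB]] Ba.
move=> /verbose_barcode0P[D' [permA _ cntA]].
have [g gK] := surj_section f_surj.
have le_card : (#|T| <= #|Z|)%N := leq_card _ (can_inj gK).
have DE : perm_eq D [seq a i | i <- index_iota 1 #|T|].
  apply: (perm_map_inj (@EFin_inj R)); rewrite -map_comp.
  by apply: perm_trans Ba; rewrite perm_sym (perm_finite_death_times permB).
have D'E : perm_eq D' (D ++ nseq (#|Z| - #|T|) 0).
  apply: perm_eq_count_le => t; rewrite count_cat count_nseq cntA cntB.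
  rewrite -[(<= t) 0]/(0 <= t); have [t0|t0] := leP 0 t.
    by rewrite mul1n (dim_edge_span_pullback _ _ gK).
  by rewrite !edge_span_neg // !dimv0 mul0n.
have sD : size D = (#|T|).-1.
  by rewrite (perm_size DE) size_map size_iota subn1.
have sD' : size D' = (#|Z|).-1.
  by rewrite (perm_size D'E) size_cat size_nseq sD; lia.
apply: (perm_trans permA); rewrite sD' /barcode_of_deaths.
(* Exactly one bar is infinite; it is moved to the front, to index 0. *)
rewrite (_ : #|Z| - (#|Z|).-1 = 1)%N; last lia.
rewrite perm_catC /= -[X in iota 0 X]prednK ?(leq_trans T0) //= perm_cons.
have -> : (#|Z|.-1 = #|T|.-1 + (#|Z| - #|T|))%N by lia.
rewrite iotaD map_cat.
apply: (perm_trans (perm_map _ D'E)); rewrite map_cat perm_cat //.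
  rewrite (perm_trans (perm_map _ DE)) // -map_comp /index_iota subn1.
  rewrite (_ : map _ _ = map (fun i => (0%:E, padded_death #|T| a i)) (iota 1 #|T|.-1)) //.
  apply/eq_in_map => i; rewrite mem_iota /padded_death => /andP[i1 iT] /=.
  by rewrite gtn_eqF // (_ : (i < #|T|)%N) //; lia.
rewrite map_nseq [X in perm_eq _ X](@eq_in_map_const _ _ _ (0%:E, 0%:E)).
  by rewrite size_iota.
move=> i; rewrite mem_iota /padded_death => /andP[Ti _].
rewrite gtn_eqF ?ltnNge; last lia.
by rewrite (_ : (#|T| <= i)%N) //; lia.
Qed.

(** * Leading simplices and existence of orthogonal bases *)

(** With [rk] injective, [s] is the pivot of [c] in the sense of Gaussian elimination. *)
Definition leads (F : fieldType) (T : finType) (m : nat)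
    (rk : simplex T m -> nat) (c : chain F T m) (s : simplex T m) : Prop :=
  c s != 0 /\ forall s', c s' != 0 -> (rk s' <= rk s)%N.

(** The highest pivot among terms with nonzero coefficient cannot cancel: pivots are distinct, so
    every other such term lies strictly below it. *)
Lemma leads_sum (F : fieldType) (T : finType) (m : nat)
    (rk : simplex T m -> nat) (n : nat) (xs : 'I_n -> chain F T m)
    (lead : 'I_n -> simplex T m) (k : 'I_n -> F) (i0 : 'I_n) :
  injective rk -> injective lead -> (forall i, leads rk (xs i) (lead i)) ->
  k i0 != 0 ->
  exists i, [/\ k i != 0,
    forall j, k j != 0 -> (rk (lead j) <= rk (lead i))%N &
    leads rk (\sum_j k j *: xs j) (lead i)].
Proof.
move=> rk_inj lead_inj xs_lead ki0.
case: (@arg_maxnP _ i0 (fun i => k i != 0) (fun i => rk (lead i)) ki0).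
move=> i ki max_i; exists i; split=> //; split=> [|s].
  rewrite sum_ffunE (bigD1 i) //= big1 => [|j ji].
    by rewrite addr0 ffunE mulf_neq0 //; case: (xs_lead i).
  rewrite ffunE; have [->|kj] := eqVneq (k j) 0; first by rewrite scale0r.
  have [->|xji] := eqVneq (xs j (lead i)) 0; first by rewrite scaler0.
  case: (xs_lead j) => _ /(_ _ xji) le_ij.
  have /rk_inj/lead_inj eq_ij : rk (lead i) = rk (lead j).
    by apply/eqP; rewrite eqn_leq le_ij; apply: max_i.
  by rewrite eq_ij eqxx in ji.
apply: contraNT; rewrite -ltnNge sum_ffunE => lt_is; apply/eqP/big1 => j _.
rewrite ffunE; have [->|kj] := eqVneq (k j) 0; first by rewrite scale0r.
have [->|xjs] := eqVneq (xs j s) 0; first by rewrite scaler0.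
case: (xs_lead j) => _ /(_ _ xjs) le_sj.
by have := leq_trans lt_is (leq_trans le_sj (max_i j kj)); rewrite ltnn.
Qed.

Lemma leads_level (R : realType) (F : fieldType) (T : finType)
    (d : pseudoMetricOn R T) (m : nat) (rk : simplex T m -> nat)
    (c : chain F T m) (s : simplex T m) :
  (forall s s', (rk s <= rk s')%N -> diam d (val s) <= diam d (val s')) ->
  leads rk c s -> level d c = (diam d (val s))%:E.
Proof.
move=> rk_diam [cs le_s]; apply/eqP; rewrite eq_le; apply/andP; split.
  by apply/level_leP => s' /le_s/rk_diam.
by apply: (bigmax_sup s).
Qed.

(** A combination inherits the highest pivot of its terms, whose diameter is both its level and the
    largest level of a term. *)
Lemma leads_orthogonal (R : realType) (F : fieldType) (T : finType)
    (d : pseudoMetricOn R T) (m : nat) (rk : simplex T m -> nat)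
    (xs : seq (chain F T m)) (lead : 'I_(size xs) -> simplex T m) :
  injective rk ->
  (forall s s', (rk s <= rk s')%N -> diam d (val s) <= diam d (val s')) ->
  injective lead -> (forall i : 'I_(size xs), leads rk xs`_i (lead i)) ->
  level_orthogonal d xs.
Proof.
move=> rk_inj rk_diam lead_inj xs_lead lam.
have [/existsP[i0 lam0]|/existsPn lam0] := boolP [exists i, lam i != 0].
  have [i [lami le_i lead_i]] := leads_sum rk_inj lead_inj xs_lead lam0.
  rewrite (leads_level rk_diam lead_i); apply/eqP; rewrite eq_le.
  apply/andP; split.
    by apply: (bigmax_sup i) => //; rewrite (leads_level rk_diam (xs_lead i)).
  apply/bigmax_leP; split=> [|j /le_i/rk_diam]; first exact: leNye.
  by rewrite (leads_level rk_diam (xs_lead j)) lee_fin.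
rewrite big1 => [|i _]; last by move: (lam0 i) => /negPn/eqP ->; rewrite scale0r.
by rewrite level0 big_pred0 // => i; apply/negbTE/lam0.
Qed.

Lemma level_orthogonal_free (R : realType) (F : fieldType) (T : finType)
    (d : pseudoMetricOn R T) (m : nat) (xs : seq (chain F T m)) :
  level_orthogonal d xs -> 0 \notin xs -> free xs.
Proof.
move=> oxs xs0; apply/(@freeP _ _ _ (in_tuple xs)) => k sum0 i.
apply/eqP; apply: contraNT xs0 => ki.
have := oxs k; rewrite [X in level d X]sum0 level0 => /esym maxNy.
have : (level d xs`_i <= -oo)%E by rewrite -maxNy; apply: (bigmax_sup i).
by rewrite leeNy_eq level_eqNy => /eqP <-; apply: mem_nth.
Qed.

(** The position in a list sorted by diameter also breaks the ties, as unique pivots require. *)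
Lemma diam_rank (R : realType) (T : finType) (d : pseudoMetricOn R T)
    (m : nat) :
  exists2 rk : simplex T m -> nat, injective rk &
    forall s s', (rk s <= rk s')%N -> diam d (val s) <= diam d (val s').
Proof.
pose le_diam (s s' : simplex T m) := diam d (val s) <= diam d (val s').
pose es := sort le_diam (enum {: simplex T m}).
have mem_es s : s \in es by rewrite mem_sort mem_enum.
exists (index^~ es) => [s s'|s s' le_ss'].
  by move/(congr1 (nth s es)); rewrite !nth_index.
have le_trans_diam : transitive le_diam by move=> u v w; apply: le_trans.
apply: (sorted_leq_index le_trans_diam) => //; first by move=> u; apply: lexx.
by apply: sort_sorted => u v; apply: le_total.
Qed.

(* Singular value decomposition of the boundary: processing the simplices by
   increasing diameter, each one leads either a cycle or itself. *)
Lemma exists_orthogonal_bdry_basis (R : realType) (F : fieldType) (T : finType)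
    (d : pseudoMetricOn R T) (k : nat) :
  exists ys1 ys2 : seq (chain F T k.+1),
    [/\ level_orthogonal d (ys1 ++ ys2), basis_of fullv (ys1 ++ ys2),
        free (map (bdry F T k) ys1) &
        {subset ys2 <= lker (bdry F T k)}].
Proof.
have [rk rk_inj rk_diam] := diam_rank d k.+1.
(* [y s] is a cycle led by [s] if there is one, and the simplex [s] itself otherwise. *)
have /choice[y y_spec] : forall s : simplex T k.+1, exists y : chain F T k.+1,
    leads rk y s /\
    forall c : chain F T k.+1, bdry F T k c = 0 -> leads rk c s -> bdry F T k y = 0.
  move=> s.
  have [[c [c0 cs]]|nc] := pselect (exists c : chain F T k.+1,
    bdry F T k c = 0 /\ leads rk c s); first by exists c.
  exists (delta_chain F s); split=> [|c c0 cs]; last by case: nc; exists c.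
  split=> [|s']; rewrite ffunE; first by rewrite eqxx oner_neq0.
  by case: (eqVneq s' s) => [->//|_]; rewrite eqxx.
pose es1 := [seq s <- enum {: simplex T k.+1} | bdry F T k (y s) != 0].
pose es2 := [seq s <- enum {: simplex T k.+1} | ~~ (bdry F T k (y s) != 0)].
have perm_es : perm_eq (es1 ++ es2) (enum {: simplex T k.+1}).
  exact/permPl/perm_filterC.
have lead_map es : uniq es -> exists lead : 'I_(size (map y es)) -> simplex T k.+1,
    [/\ injective lead, forall i, lead i \in es,
        forall i : 'I_(size (map y es)), (map y es)`_i = y (lead i) &
        forall i : 'I_(size (map y es)), leads rk (map y es)`_i (lead i)].
  move=> es_uniq; pose lead i := tnth (in_tuple es) (cast_ord (size_map y es) i).
  have leadE (i : 'I_(size (map y es))) : (map y es)`_i = y (lead i).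
    rewrite (nth_map (lead i)) ?(leq_trans (ltn_ord i)) ?size_map //.
    by congr y; apply/esym/tnth_nth.
  exists lead; split=> // [i j|i|i]; last by rewrite leadE; case: (y_spec (lead i)).
    by move/(tuple_uniqP (in_tuple es) es_uniq)/cast_ord_inj.
  exact: mem_tnth.
have y_neq0 s : y s != 0.
  by apply/chain_neq0P; exists s; case: (y_spec s) => [[]].
have es_uniq : uniq (es1 ++ es2) by rewrite (perm_uniq perm_es) enum_uniq.
exists (map y es1), (map y es2); rewrite -map_cat.
have ortho : level_orthogonal d (map y (es1 ++ es2)).
  have [lead [lead_inj _ _ y_lead]] := lead_map _ es_uniq.
  exact: leads_orthogonal rk_inj rk_diam lead_inj y_lead.
split=> //.
- rewrite basisEfree subvf (level_orthogonal_free ortho) /=.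
    rewrite dimvf /dim /= /dim /= muln1 size_map (perm_size perm_es).
    by rewrite -cardE.
  by apply/mapP => -[s _ /esym/eqP]; rewrite (negPf (y_neq0 s)).
- have es1_uniq : uniq es1 by move: es_uniq; rewrite cat_uniq => /andP[].
  have [lead [lead_inj lead_es1 leadE y_lead]] := lead_map _ es1_uniq.
  apply/(@freeP _ _ _ (map_tuple (bdry F T k) (in_tuple (map y es1)))).
  move=> lam sum0.
  have {}sum0 : bdry F T k (\sum_i lam i *: (map y es1)`_i) = 0.
    rewrite linear_sum -[RHS]sum0; apply: eq_bigr => i _.
    by rewrite linearZ /= (nth_map 0).
  (* A cycle combined from [es1] would be led by some [s] in [es1], and [y s] would then be a
     cycle. *)
  move=> i0; apply/eqP; apply: contraT => lam0.
  have [i [_ _ lead_i]] := leads_sum rk_inj lead_inj y_lead lam0.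
  have := lead_es1 i; rewrite mem_filter => /andP[/eqP[]].
  by case: (y_spec (lead i)) => _ /(_ _ sum0 lead_i).
- by move=> _ /mapP[s + ->]; rewrite mem_filter negbK memv_ker => /andP[].
Qed.

(** The boundaries of [ys1] alone span the image; by rank-nullity the free family [ys2] then has as
    many elements as the kernel has dimensions. *)
Lemma bdry_basis_split (F : fieldType) (T : finType) (k : nat)
    (ys1 ys2 : seq (chain F T k.+1)) :
  basis_of fullv (ys1 ++ ys2) -> free (map (bdry F T k) ys1) ->
  {subset ys2 <= lker (bdry F T k)} ->
  basis_of (limg (bdry F T k)) (map (bdry F T k) ys1) /\
  basis_of (lker (bdry F T k)) ys2.
Proof.
move=> bys free1 ker2; have /andP[/eqP span_ys free_ys] := bys.
have limgE : limg (bdry F T k) = <<map (bdry F T k) ys1>>%VS.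
  rewrite -span_ys limg_span map_cat span_cat; apply/addv_idPl.
  apply/span_subvP => _ /mapP[y /ker2 + ->].
  by rewrite memv_ker => /eqP ->; rewrite mem0v.
split; first by rewrite /basis_of limgE eqxx.
rewrite basisEfree (catr_free free_ys) /=; apply/andP; split; first exact/span_subvP.
rewrite -(leq_add2r (\dim (limg (bdry F T k)))).
rewrite -{1}[lker _]capfv limg_ker_dim limgE (eqnP free1) size_map addnC.
by rewrite -size_cat (@size_basis _ _ _ _ (in_tuple (ys1 ++ ys2)) bys).
Qed.

(** All nonzero 0-chains have level 0, so it suffices that no nontrivial combination vanishes. *)
Lemma free_level_orthogonal1 (R : realType) (F : fieldType) (T : finType)
    (d : pseudoMetricOn R T) (xs : seq (chain F T 1)) :
  free xs -> level_orthogonal d xs.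
Proof.
move=> free_xs lam.
have [/existsP[i lami]|/existsPn lam0] := boolP [exists i, lam i != 0].
  rewrite level_chain1; last first.
    apply: contraNneq lami => /(@freeP _ _ _ (in_tuple xs) free_xs) ->.
    by rewrite eqxx.
  have lvl j : level d xs`_j = 0%:E \/ level d xs`_j = -oo%E.
    by have [->|/(level_chain1 d)->] := eqVneq xs`_j 0; [right; rewrite level0|left].
  apply/eqP; rewrite eq_le; apply/andP; split.
    apply: (bigmax_sup i) => //; rewrite level_chain1 //.
    exact/(free_not0 free_xs)/mem_nth.
  by apply/bigmax_leP; split=> [|j _]; rewrite ?leNye //;
    case: (lvl j) => ->; rewrite ?leNye.
rewrite big1 => [|i _]; last by move: (lam0 i) => /negPn/eqP ->; rewrite scale0r.
by rewrite level0 big_pred0 // => i; apply/negbTE/lam0.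
Qed.

(** A tripod yields a cost only if its barcodes exist, which the upper bound requires. The
    boundaries of [ys1] are completed by any basis of a complement, since freeness suffices for
    orthogonality in degree 0. *)
Lemma verbose_barcode0_exists (R : realType) (F : fieldType) (T : finType)
    (d : pseudoMetricOn R T) : exists B, is_verbose_barcode F d 0 B.
Proof.
have [ys1 [ys2 [oys bys free1 ker2]]] := exists_orthogonal_bdry_basis F d 1.
have [bim bker] := bdry_basis_split bys free1 ker2.
pose xs := map (bdry F T 1) ys1 ++ vbasis (limg (bdry F T 1))^C.
have bxs : basis_of fullv xs.
  rewrite -(addv_complf (limg (bdry F T 1))).
  apply: cat_basis (vbasisP _) => //; exact/directv_addP/capv_compl.
eexists; exists (ys1 ++ ys2), xs => /=.
rewrite (@size_basis _ _ _ _ (in_tuple _) bim) size_map lker_bdry0.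
rewrite drop_size_cat // -[X in take X xs](size_map (bdry F T 1) ys1).
rewrite take_size_cat //; split=> //.
- by split=> //; apply/free_level_orthogonal1/(basis_free bxs).
- by move=> i ir; rewrite /xs !nth_cat size_map ir (nth_map 0).
Qed.

Lemma is_verbose_barcode_perm (R : realType) (F : fieldType) (T : finType)
    (d : pseudoMetricOn R T) (k : nat) (B B' : seq (bar R)) :
  perm_eq B B' -> is_verbose_barcode F d k B -> is_verbose_barcode F d k B'.
Proof.
move=> permBB' [ys [xs [ys_ortho xs_ortho bases bd permB]]].
by exists ys, xs; split=> //; apply: perm_trans permB; rewrite perm_sym.
Qed.

(** * Lower bounds for the cost of a matching *)

Lemma bar_distC (R : realType) (x y : bar R) : bar_dist x y = bar_dist y x.
Proof.
have abseBC (p p' : \bar R) : (`|p - p'| = `|p' - p|)%E.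
  by case: p p' => [p||] [p'||] //=; rewrite distrC.
by case: x y => [p [q||]] [p' [q'||]]; rewrite /bar_dist //= (abseBC p) // distrC.
Qed.

Lemma bar_dist_death_le (R : realType) (x y : bar R) (c : R) :
  (bar_dist x y <= c%:E)%E -> (x.2 <= y.2 + c%:E)%E.
Proof.
case: x y => [p [q||]] [p' [q'||]]; rewrite /bar_dist //= ?leNye //.
by rewrite ge_max lee_fin => /andP[_]; rewrite ler_norml => /andP[_]; rewrite lerBlDl.
Qed.

Lemma count_le_inj (S T : Type) (P : pred S) (Q : pred T) (s : seq S)
    (t : seq T) (f : 'I_(size s) -> 'I_(size t)) :
  injective f ->
  (forall i, P (tnth (in_tuple s) i) -> Q (tnth (in_tuple t) (f i))) ->
  (count P s <= count Q t)%N.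
Proof.
move=> f_inj PQ; rewrite -!sum1_count (big_tnth _ _ s) (big_tnth _ _ t) !sum1dep_card.
rewrite -(card_imset _ f_inj); apply: subset_leq_card.
by apply/fintype.subsetP => _ /imsetP[i + ->]; rewrite !inE; apply: PQ.
Qed.

(* If [eps j + c < del j], the [j + 1] bars of [A] with death at least [del j]
   cannot be matched, as at most [j] bars of [B] have death above [eps j]. *)
Lemma matched_death_le (R : realType) (A B : seq (bar R))
    (del eps : nat -> \bar R) (N j : nat) (u v c : R)
    (f : 'I_(size A) -> 'I_(size B)) :
  perm_eq A (barcode_of_deaths del N) -> perm_eq B (barcode_of_deaths eps N) ->
  {homo del : i k / (i <= k)%N >-> (k <= i)%E} ->
  {homo eps : i k / (i <= k)%N >-> (k <= i)%E} ->
  injective f ->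
  (forall i, bar_dist (tnth (in_tuple A) i) (tnth (in_tuple B) (f i)) <= c%:E)%E ->
  (j < N)%N -> del j = u%:E -> eps j = v%:E -> u - v <= c.
Proof.
move=> permA permB del_mono eps_mono f_inj f_le jN delj epsj.
rewrite leNgt; apply/negP => lt_c.
(* As [c < u - v], a bar with death at least [u] is matched to one with death above [v]. *)
have : (count (fun x : bar R => u%:E <= x.2)%E A <=
        count (fun x : bar R => v%:E < x.2)%E B)%N.
  apply: count_le_inj f_inj _ => i le_u.
  have := le_trans le_u (bar_dist_death_le (f_le i)).
  case: (tnth (in_tuple B) (f i)).2 => [w||] //=.
    by rewrite lee_fin lte_fin; lra.
  by rewrite ltry.
rewrite (permP permA) (permP permB) !count_map => le_count.
have : (j.+1 <= j)%N; last by rewrite ltnn.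
(* In [A] the indices 0 to [j] all count; in [B] only those below [j] can. *)
apply: leq_trans (leq_trans le_count _).
  rewrite -[X in iota 0 X](subnKC jN) iotaD count_cat.
  rewrite (@eq_in_count _ _ predT (iota 0 j.+1)).
    by rewrite count_predT size_iota leq_addr.
  move=> i; rewrite mem_iota /= => ij.
  by rewrite -delj del_mono // -ltnS.
rewrite -[X in iota 0 X](subnKC (ltnW jN)) iotaD count_cat.
rewrite (@eq_in_count _ _ pred0 (iota (0 + j) _)).
  rewrite count_pred0 addn0; apply: leq_trans (count_size _ _) _.
  by rewrite size_iota.
move=> i; rewrite mem_iota add0n /= => /andP[ji _].
by apply/negbTE; rewrite -leNgt -epsj eps_mono.
Qed.

(** Nonnegativity keeps the finite deaths above the padding zeros that follow them. *)
Lemma padded_death_mono (R : realType) (n : nat) (a : nat -> R) :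
  (forall i, (1 <= i < n)%N -> 0 <= a i) ->
  (forall i j, (1 <= i)%N -> (i <= j)%N -> (j < n)%N -> a j <= a i) ->
  {homo padded_death n a : i k / (i <= k)%N >-> (k <= i)%E}.
Proof.
move=> a_ge0 a_mono i k ik; rewrite /padded_death.
have [_|i0] := eqVneq i 0%N; first by rewrite leey.
have -> : (k == 0)%N = false by lia.
have [kn|nk] := ltnP k n.
  by rewrite (leq_ltn_trans ik kn) lee_fin a_mono ?lt0n.
by case: ltnP => // ltin; rewrite lee_fin a_ge0 // lt0n i0.
Qed.

(** * Lower and upper bounds for the pullback bottleneck distance *)

Theorem proposition1p5 (R : realType) (F : fieldType)
  (X Y : finMetricType R) (n n' : nat)
  (hX0 : (0 < #|X|)%N) (hY0 : (0 < #|Y|)%N)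
  (hn : #|X| = n) (hn' : #|Y| = n') (hnn' : (n <= n')%N)
  (BX BY : seq (bar R))
  (hBX : is_verbose_barcode F (metricOn X) 0 BX)
  (hBY : is_verbose_barcode F (metricOn Y) 0 BY)
  (a b : nat -> R)
  (ha : perm_eq (finite_death_times BX) [seq (a i)%:E | i <- index_iota 1 n])
  (hb : perm_eq (finite_death_times BY) [seq (b i)%:E | i <- index_iota 1 n'])
  (ha_mono : forall i j, (1 <= i)%N -> (i <= j)%N -> (j < n)%N -> a j <= a i)
  (hb_mono : forall i j, (1 <= i)%N -> (i <= j)%N -> (j < n')%N -> b j <= b i) :
  pullback_bottleneck F 0 X Y =
  (Num.max (\big[Num.max/0]_(1 <= i < n) `|a i - b i|)
           (\big[Num.max/0]_(n <= i < n') b i))%:E.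
Proof.
have a_ge0 i : (1 <= i < n)%N -> 0 <= a i.
  move=> i_n; apply: (death_times_ge0 hBX).
  by rewrite (perm_mem ha) (map_f (fun i => (a i)%:E)) // mem_index_iota.
have b_ge0 i : (1 <= i < n')%N -> 0 <= b i.
  move=> i_n; apply: (death_times_ge0 hBY).
  by rewrite (perm_mem hb) (map_f (fun i => (b i)%:E)) // mem_index_iota.
have n0 : (0 < n)%N by rewrite -hn.
set M := Num.max _ _.
have barcodeX (Z : finType) (f : Z -> X) A : set_surj setT setT f ->
    is_verbose_barcode F (pullbackOn f (metricOn X)) 0 A ->
    perm_eq A (barcode_of_deaths (padded_death n a) #|Z|).
  by rewrite -hn => f_surj; apply: barcode_pullback hX0 f_surj hBX _; rewrite hn.
have barcodeY (Z : finType) (f : Z -> Y) A : set_surj setT setT f ->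
    is_verbose_barcode F (pullbackOn f (metricOn Y)) 0 A ->
    perm_eq A (barcode_of_deaths (padded_death n' b) #|Z|).
  by rewrite -hn' => f_surj; apply: barcode_pullback hY0 f_surj hBY _; rewrite hn'.
(* The lower bound comes first: every matching for every tripod costs at least [M]. *)
apply/eqP; rewrite eq_le; apply/andP; split; last first.
  apply/ereal_infP => _ [Z [phiX [phiY [A [B [surjX surjY + + ->]]]]]].
  move=> /barcodeX-/(_ surjX) permA /barcodeY-/(_ surjY) permB.
  apply/ereal_infP => _ [phi [psi phiK psiK] ->].
  set cost := \big[maxe/0%E]_i _.
  have [g gK] := surj_section surjY.
  have n'Z : (n' <= #|Z|)%N by rewrite -hn' (leq_card _ (can_inj gK)).
  have cost_ge i : (bar_dist (tnth (in_tuple A) i) (tnth (in_tuple B) (phi i)) <= cost)%E.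
    by apply: (bigmax_sup i).
  have : (0 <= cost)%E by apply: bigmax_ge_id.
  case: cost cost_ge => [c||] // cost_ge; last by rewrite !leey.
  rewrite !lee_fin => c0.
  have a_mono := padded_death_mono a_ge0 ha_mono.
  have b_mono := padded_death_mono b_ge0 hb_mono.
  have gap1 := matched_death_le permA permB a_mono b_mono (can_inj phiK) cost_ge.
  (* The inverse bijection gives the opposite difference; together the two bound [|a i - b i|]. *)
  have gap2 j u v : (j < #|Z|)%N -> padded_death n' b j = u%:E ->
      padded_death n a j = v%:E -> u - v <= c.
    apply: matched_death_le permB permA b_mono a_mono (can_inj psiK) _ => i.
    by rewrite bar_distC -{2}(psiK i).
  have padE m h i : (0 < i < m)%N -> @padded_death R m h i = (h i)%:E.
    by rewrite /padded_death lt0n => /andP[/negPf -> ->].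
  have pad0 m h i : (0 < i)%N -> (m <= i)%N -> @padded_death R m h i = 0%:E.
    by rewrite /padded_death lt0n ltnNge => /negPf -> ->.
  rewrite ge_max; apply/andP; split.
    rewrite big_nat_cond; apply: bigmax_le => // i /andP[/andP[i1 i_n] _].
    have i_n' := leq_trans i_n hnn'; have iZ := leq_trans i_n' n'Z.
    rewrite ler_norml; apply/andP; split; last first.
      by apply: gap1 iZ _ _; apply: padE; rewrite i1.
    rewrite lerNl opprB.
    by apply: gap2 iZ _ _; apply: padE; rewrite i1.
  rewrite big_nat_cond; apply: bigmax_le => // i /andP[/andP[ni i_n'] _].
  (* On the side of [X] index [i] carries a padding zero; [0 < n] keeps [i] away from the infinite
     bar at index 0. *)
  have i1 := leq_trans n0 ni.
  rewrite -[b i]subr0; apply: gap2 (leq_trans i_n' n'Z) _ _.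
    by apply: padE; rewrite i1.
  exact: pad0.
(* For the upper bound the tripod is the product; base points make both projections surjective. *)
have [x0 _] : exists x : X, x \in X by apply/card_gt0P.
have [y0 _] : exists y : Y, y \in Y by apply/card_gt0P.
pose Z : finType := (X * Y)%type.
pose phiX (z : Z) : X := z.1; pose phiY (z : Z) : Y := z.2.
have surjX : set_surj setT setT phiX by move=> x _; exists (x, y0).
have surjY : set_surj setT setT phiY by move=> y _; exists (x0, y).
pose A := barcode_of_deaths (padded_death n a) #|Z|.
pose B := barcode_of_deaths (padded_death n' b) #|Z|.
have A_barcode : is_verbose_barcode F (pullbackOn phiX (metricOn X)) 0 A.
  have [A' A'P] := verbose_barcode0_exists F (pullbackOn phiX (metricOn X)).
  exact: is_verbose_barcode_perm (barcodeX _ _ _ surjX A'P) A'P.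
have B_barcode : is_verbose_barcode F (pullbackOn phiY (metricOn Y)) 0 B.
  have [B' B'P] := verbose_barcode0_exists F (pullbackOn phiY (metricOn Y)).
  exact: is_verbose_barcode_perm (barcodeY _ _ _ surjY B'P) B'P.
apply: le_trans (ereal_inf_lbound _) _; first by exists Z, phiX, phiY, A, B.
have sizeAB : size A = size B by rewrite !size_map.
(* The sorted matching pairs bars of equal index. *)
apply: le_trans (ereal_inf_lbound _) _.
  by exists (cast_ord sizeAB) => //; exact: Bijective (cast_ordK _) (cast_ordKV _).
have M0 : 0 <= M by rewrite le_max bigmax_ge_id.
apply: bigmax_le => [|i _]; first by rewrite lee_fin.
have iN : (i < #|Z|)%N by rewrite (leq_trans (ltn_ord i)) // size_map size_iota.
have nth_barcode del : nth (0%E, 0%E) (barcode_of_deaths del #|Z|) i = (0%:E, del i).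
  by rewrite (nth_map 0%N) ?size_iota // nth_iota.
rewrite !(tnth_nth (0%E, 0%E)) /= !nth_barcode /bar_dist /= /padded_death.
(* The infinite bars match at cost 0. Then the cost is [|a i - b i|] below [n], [b i] from [n] to
   [n' - 1], and 0 beyond, where two padding zeros meet. *)
have [_|i0] := eqVneq (i : nat) 0%N; first by rewrite /= subrr normr0 lee_fin.
rewrite -lt0n in i0.
have [i_n|n_i] := ltnP i n.
  rewrite (leq_trans i_n hnn') /= subrr normr0 ge_max !lee_fin M0 /= le_max.
  by apply/orP; left; apply: (bigmax_sup_seq _ (nat_of_ord i)) => //; rewrite mem_index_iota i0.
have [i_n'|_] := ltnP i n'; last by rewrite /= subrr normr0 ge_max !lee_fin M0.
have bi0 : 0 <= b i by apply: b_ge0; rewrite i0.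
rewrite /= subrr normr0 sub0r normrN ger0_norm // ge_max !lee_fin M0 /= le_max.
apply/orP; right; apply: (bigmax_sup_seq _ (nat_of_ord i)) => //.
by rewrite mem_index_iota n_i.
Qed.
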